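(* Let $B$ be a skew-symmetrizable integer $n\times n$ matrix that is nondegenerate (i.e. $\det B\neq 0$). Then the exchange graphs of all cluster algebras in $\mathfrak A(B)$ coincide. That is, for any two cluster algebras $\mathcal A,\mathcal A'\in\mathfrak A(B)$, with initial seeds both attached to the same vertex $t_0$ of the $n$-regular tree $\mathbb T_n$, and for any two vertices $t_1,t_2$ of $\mathbb T_n$, the seeds of $\mathcal A$ at $t_1$ and $t_2$ are equivalent if and only if the seeds of $\mathcal A'$ at $t_1$ and $t_2$ are equivalent.
   Context: A semifield $\mathcal P$ is a torsion-free multiplicative abelian group endowed with an additional operation $\oplus$ which is commutative, associative, and such that multiplication distributes over it. The ambient field $\mathcal F$ is the field of rational functions in $n$ independent variables with coefficients in the field of fractions of the integer group ring $\mathbb Z\mathcal P$. A square matrix $B$ is skew-symmetrizable if $DB$ is skew-symmetric for some diagonal matrix $D$ with positive diagonal entries. A seed is a triple $\Sigma=(\mathbf x,\mathbf y,B)$, where $\mathbf x=(x_1,\dots,x_n)$ (the cluster; its entries are the cluster variables) is a transcendence basis of $\mathcal F$ over the field of fractions of $\mathbb Z\mathcal P$, $\mathbf y=(y_1,\dots,y_n)$ (the coefficient tuple) is an $n$-tuple of elements of $\mathcal P$, and $B=(b_{ij})$ (the exchange matrix) is a skew-symmetrizable integer $n\times n$ matrix. The seed mutation in direction $k\in[1,n]$ takes $\Sigma$ to the adjacent seed $\Sigma'=(\mathbf x',\mathbf y',B')$ defined as follows. The cluster $\mathbf x'$ is obtained from $\mathbf x$ by replacing $x_k$ with $x_k'$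 given by $$x_kx'_k=\frac{y_k}{y_k\oplus 1}\prod_{b_{ki}>0}x_i^{b_{ki}}+\frac{1}{y_k\oplus 1}\prod_{b_{ki}<0}x_i^{-b_{ki}}$$ (empty products equal $1$). The coefficients are $y'_k=y_k^{-1}$; for $j\ne k$, $y'_j=y_jy_k^{b_{jk}}(y_k\oplus1)^{-b_{jk}}$ if $b_{jk}>0$ and $y'_j=y_j(y_k\oplus1)^{-b_{jk}}$ if $b_{jk}\le 0$. The exchange matrix is $b'_{ij}=-b_{ij}$ if $i=k$ or $j=k$, and $b'_{ij}=b_{ij}+\frac{|b_{ik}|b_{kj}+b_{ik}|b_{kj}|}{2}$ otherwise. (This exchange matrix is the transpose of the one used by Fomin and Zelevinsky.) Two seeds are mutation equivalent if one is obtained from the other by a sequence of seed mutations. The cluster algebra $\mathcal A(\Sigma)$ of rank $n$ associated with an initial seed $\Sigma$ is the $\mathbb Z\mathcal P$-subalgebra of $\mathcal F$ generated by all cluster variables in all seeds mutation equivalent to $\Sigma$; these are the seeds of $\mathcal A(\Sigma)$. $\mathfrak A(B)$ denotes the family of all cluster algebras obtained by fixing the initial exchange matrix $B$ and varying the semifield $\mathcal P$, the initial coefficient tuple $\mathbf y$, and the initial cluster $\mathbf x$. Let $\mathbb T_n$ be the $n$-regular tree whose edges are labeled by $1,\dots,n$ so that the $n$ edges at each vertex receive different labels. Attaching the initial seed of $\mathcal A$ to a vertex $t_0$, every vertex of $\mathbb T_n$ receives a seed so that the endpoints of an edge labeled $k$ carry seeds adjacent in direction $k$. Two seeds are equivalent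 if they differ by a permutation $\sigma\in S_n$ of the cluster variables together with the corresponding permutation of the coefficients $\mathbf y$ and of the rows and columns of the exchange matrix. The exchange graph of $\mathcal A$ is the quotient of $\mathbb T_n$ modulo this equivalence relation. *)

(* Defs.v *)
From HB Require Import structures.
From mathcomp Require Import all_boot all_order all_fingroup all_algebra.
From mathcomp Require Import boolp classical_sets.
From mathcomp Require Import finmap.
From mathcomp Require multinomials.monalg multinomials.mpoly.

Set Implicit Arguments.
Unset Strict Implicit.
Unset Printing Implicit Defensive.

Import Order.TTheory GRing.Theory Num.Theory.
Local Open Scope ring_scope.

(* Commutativity is part of the mixin: MathComp's [groupType] has no abelian
   refinement. *)
HB.mixin Record isSemifield P of monoid.Group P := {
  mulsfC : commutative (fun x y : P => (x * y)%g);
  torsion_free : forall (x : P) (m : nat), (x ^+ m.+1)%g = 1%g -> x = 1%g;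
  oplus : P -> P -> P;
  oplusC : commutative oplus;
  oplusA : associative oplus;
  mulsfDl : left_distributive (fun x y : P => (x * y)%g) oplus
}.

#[short(type="semifieldType")]
HB.structure Definition Semifield := {P of isSemifield P & monoid.Group P}.

Definition expsfz (P : semifieldType) (x : P) (m : int) : P :=
  match m with
  | Posz k => (x ^+ k)%g
  | Negz k => (x ^- k.+1)%g
  end.

(* A torsion-free abelian group has a positive cone containing every element or
   its inverse; hence it is orderable and its group ring has no zero
   divisors. *)
Section Cone.
Variable P : semifieldType.
Local Open Scope group_scope.
Implicit Types (x y z : P) (C : set P).

Definition cone C :=
  [/\ C 1, forall x y, C x -> C y -> C (x * y)
    & forall x, C x -> C x^-1 -> x = 1].

Lemma commsf x y : commute x y. Proof. exact: mulsfC. Qed.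

Lemma sfACA x y z t : (x * y) * (z * t) = (x * z) * (y * t).
Proof. by rewrite !mulgA -(mulgA x y) (mulsfC y z) !mulgA. Qed.

Definition cone_ext C x : set P := fun z => exists s k, C s /\ z = s * x ^+ k.

Lemma cone_extP C x :
    cone C -> (forall k, C (x ^- k.+1) -> x = 1) -> cone (cone_ext C x).
Proof.
move=> [C1 CM Canti] hx; split.
- by exists 1, 0; split=> //; rewrite expg0 mulg1.
- move=> _ _ [s [k [Cs ->]]] [t [l [Ct ->]]].
  exists (s * t), (k + l)%N; split; first exact: CM.
  by rewrite expgnDr sfACA.
- move=> _ [s [k [Cs ->]]] [t [l [Ct E]]].
  have: (s * t) * x ^+ (k + l) = 1.
    by rewrite expgnDr -sfACA -E mulgV.
  case kl: (k + l)%N => [|m] stE; last first.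
    have x1 : x = 1.
      by apply: (hx m); rewrite (mulg1_eq (etrans (mulsfC _ _) stE)); apply: CM.
    have st1 : s * t = 1 by rewrite -stE x1 expg1n mulg1.
    rewrite x1 expg1n mulg1; apply: Canti => //.
    by rewrite (mulg1_eq st1).
  have k0 : k = 0%N by case: (k) kl.
  rewrite k0 expg0 mulg1; apply: Canti => //.
  by rewrite (mulg1_eq (y := t)) // -[RHS]stE expg0 mulg1.
Qed.

Lemma total_cone_exists : exists C, cone C /\ forall x, C x \/ C x^-1.
Proof.
pose Q : set (set P) := fun C => cone (C `|` [set 1])%classic.
have [F FQ Ftot|C [QC Cmax]] := @Zorn_bigcup P Q.
  split.
  - by right.
  - move=> x y [[X FX Xx]|->] [[Y FY Yy]|->]; rewrite ?mulg1 ?mul1g.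
    + case: (Ftot X Y FX FY) => XY.
        have [_ h _] := FQ Y FY.
        case: (h x y); [by left; exact: XY|by left| |by right].
        by move=> ?; left; exists Y.
      have [_ h _] := FQ X FX.
      case: (h x y); [by left|by left; exact: XY| |by right].
      by move=> ?; left; exists X.
    + by left; exists X.
    + by left; exists Y.
    + by right.
  - move=> x [[X FX Xx]|->] // [[Y FY Yy]|]; last first.
      by move/(canRL invgK)->; rewrite invg1.
    case: (Ftot X Y FX FY) => XY.
      have [_ _ h] := FQ Y FY.
      by apply: h; left => //; exact: XY.
    have [_ _ h] := FQ X FX.
    by apply: h; left => //; exact: XY.
pose D : set P := (C `|` [set 1])%classic.
have D1 : D 1 by right.
have ext x : cone (cone_ext D x) -> D x.
  move=> ce; apply: contrapT => nDx.
  apply: (Cmax (cone_ext D x)); last first.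
    rewrite /Q; suff -> : (cone_ext D x `|` [set 1] = cone_ext D x)%classic by [].
    by apply/seteqP; split=> z; [case=> [//|->]; case: ce|left].
  split=> [z Cz|sub].
    by exists z, 0%N; split; [left|rewrite expg0 mulg1].
  by apply: nDx; left; apply: sub; exists 1, 1%N; rewrite expg1 mul1g.
exists D; split=> // x; case: (pselect (D x)) => [|nDx]; first by left.
have [//|nDVx] := pselect (D x^-1); first by right.
have [[k Dk]|nk] := pselect (exists k, D (x ^- k.+1)); last first.
  by left; apply/ext/cone_extP => // k Dk; case: nk; exists k.
right; apply/ext/cone_extP => // l; rewrite expVgn invgK => Dl.
have [_ DM Danti] := QC.
have DX z m : D z -> D (z ^+ m).
  by move=> Dz; elim: m => [|m IH]; rewrite ?expg0 // expgS; apply: DM.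
suff x1 : x = 1 by rewrite x1 invg1.
apply: (@torsion_free P x (l.+1 * k.+1).-1); rewrite prednK ?muln_gt0 //.
apply: Danti; first by rewrite expgnA; apply: DX.
by rewrite mulnC expgnA -expVgn; apply: DX.
Qed.

End Cone.

(* Only the additive structure comes from [malg]: its ring structure needs a
   [monomType], in which 1 is the only unit. *)
Definition group_ring (P : semifieldType) : Type := monalg.malg P int.

Section GroupRing.
Import multinomials.monalg.
Variable P : semifieldType.
Implicit Types (g h : {malg int[P]}) (k l : P).

HB.instance Definition _ := GRing.Zmodule.on (group_ring P).

Definition gr_one : {malg int[P]} := << 1 *g 1%g >>.

Definition gr_mul g h : {malg int[P]} :=
  \sum_(k <- msupp g) \sum_(l <- msupp h) << g@_k * h@_l *g (k * l)%g >>.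

Lemma gr_mulw (d1 d2 : {fset P}) g h :
  (msupp g `<=` d1)%fset -> (msupp h `<=` d2)%fset ->
  gr_mul g h =
    \sum_(k <- d1) \sum_(l <- d2) << g@_k * h@_l *g (k * l)%g >>.
Proof.
move=> le1 le2; rewrite /gr_mul (big_fset_incl _ le1) /=.
  apply/eq_bigr=> k _; apply/big_fset_incl => // l _ /mcoeff_outdom ->.
  by rewrite mulr0 monalgU0.
move=> k _ /mcoeff_outdom gk.
by rewrite big1 => // l _; rewrite gk mul0r monalgU0.
Qed.

Lemma gr_mulC : commutative gr_mul.
Proof.
move=> g h; rewrite /gr_mul exchange_big /=.
by apply/eq_bigr=> l _; apply/eq_bigr=> k _; rewrite mulrC mulsfC.
Qed.

Lemma gr_mulDl : left_distributive gr_mul +%R.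
Proof.
move=> g1 g2 g.
rewrite (gr_mulw (msuppD_le g1 g2) (fsubset_refl _)).
rewrite (gr_mulw (fsubsetUl _ (msupp g2)) (fsubset_refl (msupp g))).
rewrite (gr_mulw (fsubsetUr (msupp g1) _) (fsubset_refl (msupp g))).
rewrite -big_split /=; apply/eq_bigr=> k1 _.
rewrite -big_split /=; apply/eq_bigr=> k2 _.
by rewrite mcoeffD mulrDl monalgUD.
Qed.

Lemma gr_mulDr : right_distributive gr_mul +%R.
Proof. by move=> g g1 g2; rewrite gr_mulC gr_mulDl !(gr_mulC g). Qed.

Lemma gr_mul0g : left_zero 0 gr_mul.
Proof. by move=> g; rewrite /gr_mul msupp0 big_seq_fset0. Qed.

Lemma gr_mulg0 : right_zero 0 gr_mul.
Proof. by move=> g; rewrite gr_mulC gr_mul0g. Qed.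

Lemma gr_mulUU (a b : int) k l :
  gr_mul << a *g k >> << b *g l >> = << a * b *g (k * l)%g >>.
Proof. by rewrite (gr_mulw msuppU_le msuppU_le) !big_seq_fset1 !mcoeffUU. Qed.

Lemma gr_mulUg (a : int) k g :
  gr_mul << a *g k >> g = \sum_(l <- msupp g) << a * g@_l *g (k * l)%g >>.
Proof.
rewrite (gr_mulw msuppU_le (fsubset_refl _)) big_seq_fset1.
by apply/eq_bigr=> l _; rewrite mcoeffUU.
Qed.

Lemma gr_mulEl g h :
  gr_mul g h = \sum_(k <- msupp g) gr_mul << g@_k *g k >> h.
Proof. by apply/eq_bigr=> k _; rewrite gr_mulUg. Qed.

Lemma gr_mulEr g h :
  gr_mul g h = \sum_(l <- msupp h) gr_mul g << h@_l *g l >>.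
Proof.
by rewrite gr_mulC gr_mulEl; apply/eq_bigr=> l _; rewrite gr_mulC.
Qed.

Lemma gr_mulA : associative gr_mul.
Proof.
move=> g1 g2 g3.
rewrite [RHS](big_morph (gr_mul^~ _) (fun _ _ => gr_mulDl _ _ _) (gr_mul0g _)).
rewrite gr_mulEl; apply/eq_bigr=> k1 _.
rewrite [LHS](big_morph (gr_mul _) (fun _ _ => gr_mulDr _ _ _) (gr_mulg0 _)).
rewrite [RHS](big_morph (gr_mul^~ _) (fun _ _ => gr_mulDl _ _ _) (gr_mul0g _)).
apply/eq_bigr=> k2 _.
rewrite [LHS](big_morph (gr_mul _) (fun _ _ => gr_mulDr _ _ _) (gr_mulg0 _)).
by rewrite gr_mulEr; apply/eq_bigr=> k3 _; rewrite !gr_mulUU mulrA mulgA.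
Qed.

Lemma gr_mul1g : left_id gr_one gr_mul.
Proof.
move=> g; rewrite gr_mulUg [RHS]monalgE.
by apply/eq_bigr=> k _; rewrite mul1r mul1g.
Qed.

Lemma gr_oner_neq0 : gr_one != 0.
Proof. by rewrite monalgU_eq0. Qed.

HB.instance Definition _ := GRing.Zmodule_isComNzRing.Build (group_ring P)
  gr_mulA gr_mulC gr_mul1g gr_mulDl gr_oner_neq0.

Definition gr_unit : pred (group_ring P) :=
  fun g => `[< exists h : group_ring P, h * g = 1 >].

Definition gr_inv (g : group_ring P) : group_ring P :=
  if pselect (exists h : group_ring P, h * g = 1) is left e
  then projT1 (cid e) else g.

Lemma gr_mulVr : {in gr_unit, left_inverse 1 gr_inv *%R}.
Proof.
move=> g /asboolP e; rewrite /gr_inv; case: pselect => // e'.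
by case: (cid e').
Qed.

Lemma gr_unitP (g h : group_ring P) : h * g = 1 -> gr_unit g.
Proof. by move=> e; apply/asboolP; exists h. Qed.

Lemma gr_invr_out : {in [predC gr_unit], gr_inv =1 id}.
Proof.
move=> g /negP ng; rewrite /gr_inv; case: pselect => // e.
by case: ng; apply/asboolP.
Qed.

HB.instance Definition _ := GRing.ComNzRing_hasMulInverse.Build (group_ring P)
  gr_mulVr gr_unitP gr_invr_out.

Lemma gr_max (C : set P) (s : seq P) : cone C -> (forall x, C x \/ C x^-1%g) ->
  s != [::] -> exists2 m, m \in s & {in s, forall k, C (k^-1 * m)%g}.
Proof.
move=> [C1 CM _] Ctot; elim: s => // a s IH _.
case: (eqVneq s [::]) => [->|/IH [m ms mmax]].
  by exists a => [|k]; rewrite inE // => /eqP ->; rewrite mulVg.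
case: (Ctot (a^-1 * m)%g) => am.
  exists m; first by rewrite inE ms orbT.
  by move=> k; rewrite inE => /predU1P[->|/mmax].
exists a; first by rewrite mem_head.
move=> k; rewrite inE => /predU1P[->|/mmax km]; first by rewrite mulVg.
have := CM _ _ km am.
by rewrite invgM invgK mulgA mulgK.
Qed.

Lemma gr_idomain (g h : group_ring P) :
  g * h = 0 -> (g == 0) || (h == 0).
Proof.
move=> gh0; apply: contraT; rewrite negb_or => /andP[g0 h0].
have [C [Ccone Ctot]] := total_cone_exists P.
have supp0 (f : {malg int[P]}) : f != 0 -> (msupp f : seq P) != [::].
  apply: contra_neq => E; apply/malgP=> k; rewrite mcoeff0 mcoeff_outdom //.
  by rewrite -[k \in _]/(k \in (msupp f : seq P)) E.
have [k kg kmax] := gr_max Ccone Ctot (supp0 _ g0).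
have [l lh lmax] := gr_max Ccone Ctot (supp0 _ h0).
have [_ CM Canti] := Ccone.
have /malgP/(_ (k * l)%g) : gr_mul g h = 0 by [].
rewrite mcoeff0 /gr_mul raddf_sum (big_fsetD1 k) //= raddf_sum.
rewrite (big_fsetD1 l) //= mcoeffUU.
rewrite [X in _ + X + _]big1_fset ?addr0; last first.
  move=> l'; rewrite in_fsetD1 => /andP[l'l _] _; rewrite mcoeffU.
  by case: eqP => // /mulgI ll; rewrite ll eqxx in l'l.
rewrite [X in _ + X]big1_fset ?addr0; last first.
  move=> k'; rewrite in_fsetD1 => /andP[k'k k'g] _.
  rewrite raddf_sum big1_fset // => l' l'h _ /=; rewrite mcoeffU.
  case: eqP => // E; case/eqP: k'k; apply/eqP; rewrite eq_sym -divg_eq1.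
  apply/eqP/Canti; first by rewrite mulsfC; apply: kmax.
  rewrite invgF; suff -> : (k' * k^-1 = l'^-1 * l)%g by apply: lmax.
  apply: (@mulIg _ k); rewrite mulgVK -mulgA [(l * k)%g]mulsfC -E.
  by rewrite mulsfC mulgK.
move/eqP; rewrite mulf_eq0 !mcoeff_eq0.
by rewrite kg lh.
Qed.

HB.instance Definition _ :=
  GRing.ComUnitRing_isIntegral.Build (group_ring P) gr_idomain.

Definition gr_inj (p : P) : group_ring P := (<< 1 *g p >> : {malg int[P]}).

End GroupRing.

Import multinomials.mpoly.

Definition coef_field (P : semifieldType) : fieldType :=
  {fraction (group_ring P)}.

Definition ambient (P : semifieldType) (n : nat) : fieldType :=
  {fraction {mpoly (coef_field P)[n]}}.

Definition scal (P : semifieldType) (n : nat) (c : coef_field P) : ambient P n :=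
  tofrac (mpolyC n c).

Definition sf_inj (P : semifieldType) (n : nat) (p : P) : ambient P n :=
  scal n (tofrac (gr_inj p)).

Definition eval_at (P : semifieldType) (n : nat) (x : 'I_n -> ambient P n)
    (p : {mpoly (coef_field P)[n]}) : ambient P n :=
  mmap (@scal P n) x p.

Definition algebraically_independent (P : semifieldType) (n : nat)
    (x : 'I_n -> ambient P n) :=
  forall p : {mpoly (coef_field P)[n]}, eval_at x p = 0 -> p = 0.

Definition in_adjoined_field (P : semifieldType) (n : nat)
    (x : 'I_n -> ambient P n) (f : ambient P n) :=
  exists p q : {mpoly (coef_field P)[n]},
    eval_at x q != 0 /\ f = eval_at x p / eval_at x q.

Definition transcendence_basis (P : semifieldType) (n : nat)
    (x : 'I_n -> ambient P n) :=
  algebraically_independent x /\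
  forall f : ambient P n, exists q : {poly ambient P n},
    [/\ q != 0, forall i, in_adjoined_field x q`_i & root q f].

Definition skew_symmetrizable (n : nat) (B : 'M[int]_n) :=
  exists d : 'rV[int]_n,
    (forall i, 0 < d 0 i) /\ (diag_mx d *m B)^T = - (diag_mx d *m B).

(* Raw triples; the conditions on the entries are in [is_seed]. *)
Record seed (P : semifieldType) (n : nat) := Seed {
  cluster : {ffun 'I_n -> ambient P n};
  coeffs : {ffun 'I_n -> P};
  exchange_mx : 'M[int]_n
}.

Definition is_seed (P : semifieldType) (n : nat) (S : seed P n) :=
  transcendence_basis (cluster S) /\ skew_symmetrizable (exchange_mx S).

Section Mutation.
Variables (P : semifieldType) (n : nat) (k : 'I_n) (S : seed P n).
Local Notation x := (cluster S).
Local Notation y := (coeffs S).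
Local Notation B := (exchange_mx S).
Local Notation yk1 := (oplus (y k) 1%g).

Definition exchange_rhs : ambient P n :=
  sf_inj n (y k * yk1^-1)%g * \prod_(i | 0 < B k i) x i ^ (B k i)
  + sf_inj n (yk1^-1)%g * \prod_(i | B k i < 0) x i ^ (- B k i).

Definition mut_cluster : {ffun 'I_n -> ambient P n} :=
  [ffun i => if i == k then exchange_rhs / x k else x i].

Definition mut_coeffs : {ffun 'I_n -> P} :=
  [ffun j =>
    if j == k then (y k)^-1%g
    else if 0 < B j k
    then (y j * expsfz (y k) (B j k) * expsfz yk1 (- B j k))%g
    else (y j * expsfz yk1 (- B j k))%g].

(* The division by 2 is exact. *)
Definition mut_mx : 'M[int]_n :=
  \matrix_(i, j)
    if (i == k) || (j == k) then - B i j
    else B i j + ((`|B i k| * B k j + B i k * `|B k j|) %/ 2)%Z.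

Definition mutation : seed P n := Seed mut_cluster mut_coeffs mut_mx.

End Mutation.

Definition seed_equiv (P : semifieldType) (n : nat) (S S' : seed P n) :=
  exists s : 'S_n,
    [/\ forall i, cluster S' i = cluster S (s i),
        forall i, coeffs S' i = coeffs S (s i)
      & forall i j, exchange_mx S' i j = exchange_mx S (s i) (s j)].

(* The vertices of the n-regular tree, encoded as the words in the edge labels
   with no two equal consecutive letters: a word lists the labels of the
   geodesic from a base vertex, last edge first. *)
Definition reduced (n : nat) : pred (seq 'I_n) :=
  sorted (fun i j : 'I_n => i != j).

Definition tree (n : nat) := {w : seq 'I_n | reduced w}.

Definition nbr_word (n : nat) (k : 'I_n) (w : seq 'I_n) : seq 'I_n :=
  if w is j :: w' then if k == j then w' else k :: w else [:: k].

Lemma nbr_word_reduced (n : nat) (k : 'I_n) (w : seq 'I_n) :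
  reduced w -> reduced (nbr_word k w).
Proof.
rewrite /reduced; case: w => [|j w] //= jw; case: ifPn => [_|kj] /=.
  exact: path_sorted jw.
by rewrite kj.
Qed.

Definition nbr (n : nat) (k : 'I_n) (t : tree n) : tree n :=
  exist _ (nbr_word k (sval t)) (nbr_word_reduced k (svalP t)).

Lemma nbrK (n : nat) (k : 'I_n) : involutive (@nbr n k).
Proof.
case=> w rw; apply/val_inj => /=; case: w rw => [|j w] /=; first by rewrite eqxx.
case: (eqVneq k j) => [->|kj]; last by rewrite /= eqxx.
by case: w => [|i w] //= /andP[/negPf ->].
Qed.

(* A cluster algebra of rank [n] over [P] is encoded by the family of seeds it
   attaches to the vertices of the tree: a valid initial seed, with exchange
   matrix [B], sits at [t0], and the endpoints of an edge labeled [k] carry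
   seeds adjacent in direction [k]. *)
Definition seed_pattern (P : semifieldType) (n : nat) (B : 'M[int]_n)
    (t0 : tree n) (Sigma : tree n -> seed P n) :=
  [/\ is_seed (Sigma t0), exchange_mx (Sigma t0) = B
    & forall (t : tree n) (k : 'I_n), Sigma (nbr k t) = mutation k (Sigma t)].

(* Main.v *)
Require Import Defs.
From HB Require Import structures.
From mathcomp Require Import all_boot all_order all_fingroup all_algebra.
From mathcomp Require Import boolp.
From mathcomp Require multinomials.monalg multinomials.mpoly.
From mathcomp Require Import zify ring.

(** To a seed (x, y, B) attach the elements
    yhat_j = y_j * prod_i x_i ^ b_ji of the ambient field.  By the exchange
    relations they mutate by the rule of the coefficients, with the addition
    of the field in place of the semifield addition ([yhat_mutation]).  If
    det B <> 0, the map v |-> v B is injective on exponent vectors, so distinct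
    monomials in the initial yhat_j are distinct multiples of Laurent monomials
    in the initial cluster; as those are linearly independent
    ([laurent_indep]), the initial yhat_j satisfy no nontrivial relation
    between polynomials with natural coefficients ([laurent_sf_free]).

    The ratios of nonempty sums of Laurent monomials with coefficients in P
    form a subset of the field closed under addition, multiplication and
    inversion, and missing 0.  Such a subset is a semifield ([cone_sf]); it is
    torsion-free because z ^ m = 1 with z <> 1 would make the positive element
    1 + z + ... + z ^ (m - 1) vanish.  All cluster variables, hence all yhat_j,
    lie in it.

    Semifield operations on free generators specialize to any other semifield:
    two subtraction-free expressions that agree on the free generators have,
    after clearing denominators, the same multiset of monomials, so they agree
    everywhere.  Thus an equality between entries of the yhat-pattern of one
    cluster algebra, at two vertices of the tree, forces the same equality in
    every pattern of elements of any semifield that mutates with the same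
    matrices ([free_y_pattern_universal]).

    Let the seeds of A at t1 and t2 be equivalent under s.  Then their yhat
    agree up to s.  Specializing to the semifield of A' gives the same for the
    coefficients of A', and specializing to the semifield inside the ambient
    field of A' gives it for the yhat of A'.  The ratios
    z_i = x'_i(t2) / x'_(s i)(t1) therefore satisfy prod_i z_i ^ m_ji = 1 for
    all j, where M is the matrix at t2, whose determinant is still nonzero.
    Multiplying by the adjugate gives z_i ^ det M = 1, whence z_i = 1 by
    torsion-freeness. *)

Set Implicit Arguments.
Unset Strict Implicit.
Unset Printing Implicit Defensive.

Import Order.TTheory GRing.Theory Num.Theory.
Local Open Scope ring_scope.

(** * Adjoining a zero to a semifield *)

(** With an absorbing element 0 (here [None]) a semifield becomes a commutative
    semiring, so that sums over possibly empty lists, and distributivity over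
    them, come from the theory of big operators. *)
Definition with_zero (P : semifieldType) : Type := option P.

Section WithZero.
Variable P : semifieldType.
Implicit Types u v w : with_zero P.

HB.instance Definition _ := Choice.on (with_zero P).

Definition wz_add u v : with_zero P :=
  match u, v with
  | Some a, Some b => Some (oplus a b)
  | None, _ => v
  | _, None => u
  end.

Definition wz_mul u v : with_zero P :=
  match u, v with
  | Some a, Some b => Some (a * b)%g
  | _, _ => None
  end.

Lemma wz_addA : associative wz_add.
Proof. by case=> [a|] [b|] [c|] //=; rewrite oplusA. Qed.

Lemma wz_addC : commutative wz_add.
Proof. by case=> [a|] [b|] //=; rewrite oplusC. Qed.

Lemma wz_add0 : left_id None wz_add. Proof. by case. Qed.

Lemma wz_mulA : associative wz_mul.
Proof. by case=> [a|] [b|] [c|] //=; rewrite mulgA. Qed.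

Lemma wz_mulC : commutative wz_mul.
Proof. by case=> [a|] [b|] //=; rewrite mulsfC. Qed.

Lemma wz_mul1 : left_id (Some 1%g) wz_mul.
Proof. by case=> [a|] //=; rewrite mul1g. Qed.

Lemma wz_mul0 : left_zero None wz_mul. Proof. by []. Qed.

Lemma wz_mulDl : left_distributive wz_mul wz_add.
Proof. by case=> [a|] [b|] [c|] //=; rewrite mulsfDl. Qed.

HB.instance Definition _ :=
  GRing.isNmodule.Build (with_zero P) wz_addA wz_addC wz_add0.
HB.instance Definition _ := GRing.Nmodule_isComPzSemiRing.Build (with_zero P)
  wz_mulA wz_mulC wz_mul1 wz_mulDl wz_mul0.

Definition wz (a : P) : with_zero P := Some a.

Lemma wzM a b : wz (a * b)%g = wz a * wz b. Proof. by []. Qed.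
Lemma wzD a b : wz (oplus a b) = wz a + wz b. Proof. by []. Qed.
Lemma wz1 : wz 1%g = 1. Proof. by []. Qed.

Lemma wz_inj : injective wz. Proof. by move=> a b []. Qed.

Lemma wzX a m : wz (a ^+ m)%g = wz a ^+ m.
Proof. by elim: m => [|m IH]; rewrite ?expg0 // expgS exprS wzM IH. Qed.

End WithZero.

(** * Subtraction-free polynomials *)

(** A polynomial with natural coefficients is a list of exponent vectors, up to
    permutation; repetition plays the part of the coefficient. *)
Section PosPoly.
Variables (P : semifieldType) (n : nat).
Implicit Types (y : 'I_n -> P) (m : 'rV[nat]_n) (s t : seq 'rV[nat]_n).

Definition monom_at y m : with_zero P := \prod_i wz (y i) ^+ m 0 i.

Definition poly_at y s : with_zero P := \sum_(m <- s) monom_at y m.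

Lemma monom_atD y m m' : monom_at y (m + m') = monom_at y m * monom_at y m'.
Proof.
by rewrite -big_split; apply: eq_bigr => i _ /=; rewrite mxE exprD.
Qed.

Lemma monom_atE y m : exists a, monom_at y m = wz a.
Proof.
rewrite /monom_at; elim/big_ind: _ => [|_ _ [a ->] [b ->]|i _].
- by exists 1%g.
- by exists (a * b)%g.
- by exists (y i ^+ m 0 i)%g; rewrite wzX.
Qed.

Lemma poly_atE y s : s != [::] -> exists a, poly_at y s = wz a.
Proof.
case: s => // m s _; rewrite /poly_at big_cons; have [a ->] := monom_atE y m.
by case: (\sum_(_ <- _) _) => [b|]; [exists (oplus a b)|exists a].
Qed.

Definition poly_mul s t := [seq m + m' | m <- s, m' <- t].

Lemma poly_mul_neq0 s t : s != [::] -> t != [::] -> poly_mul s t != [::].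
Proof. by case: s => // a s; case: t. Qed.

Lemma poly_atD y s t : poly_at y (s ++ t) = poly_at y s + poly_at y t.
Proof. exact: big_cat. Qed.

Lemma poly_atM y s t : poly_at y (poly_mul s t) = poly_at y s * poly_at y t.
Proof.
rewrite /poly_at big_allpairs_dep big_distrl /=; apply: eq_bigr => m _.
by rewrite big_distrr /=; apply: eq_bigr => m' _; rewrite monom_atD.
Qed.

(** The [y i] satisfy no relation between polynomials with natural
    coefficients: they freely generate a universal semifield. *)
Definition sf_free y :=
  forall s t, poly_at y s = poly_at y t -> perm_eq s t.

End PosPoly.

(** * Universality of free generators *)

Section Specialization.
Variables (Q P : semifieldType) (n : nat) (u : 'I_n -> Q) (y : 'I_n -> P).

(** The graph of the specialization u |-> y: some ratio s / t of nonzero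
    polynomials takes the value a at u and b at y.  Stating it as a relation
    postpones well-definedness to [spec_fun], where freeness of u enters. *)
Definition specializes (a : Q) (b : P) :=
  exists s t, [/\ t != [::], poly_at u t * wz a = poly_at u s
                           & poly_at y t * wz b = poly_at y s].

Lemma spec_gen i : specializes (u i) (y i).
Proof.
pose e : 'rV[nat]_n := \row_j (j == i : nat).
have E (T : semifieldType) (z : 'I_n -> T) :
    poly_at z [:: 0] * wz (z i) = poly_at z [:: e].
  rewrite /poly_at !big_seq1 /monom_at big1 ?mul1r => [|j _].
    rewrite (bigD1 i) //= !mxE eqxx expr1 big1 ?mulr1 // => j /negPf ji.
    by rewrite mxE ji.
  by rewrite mxE.
by exists [:: e], [:: 0]; split.
Qed.

Lemma spec1 : specializes 1%g 1%g.
Proof. by exists [:: 0], [:: 0]; rewrite !wz1 !mulr1. Qed.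

Lemma specM a b a' b' : specializes a b -> specializes a' b' ->
  specializes (a * a')%g (b * b')%g.
Proof.
move=> [s [t [t0 sa sb]]] [s' [t' [t'0 sa' sb']]].
exists (poly_mul s s'), (poly_mul t t'); split; first exact: poly_mul_neq0.
  by rewrite !poly_atM wzM mulrACA sa sa'.
by rewrite !poly_atM wzM mulrACA sb sb'.
Qed.

Lemma specV a b : specializes a b -> specializes a^-1%g b^-1%g.
Proof.
move=> [s [t [t0 sa sb]]]; exists t, s; split.
- have [c tc] := poly_atE u t0; apply/eqP => s0.
  by move: sa; rewrite s0 tc -wzM /poly_at big_nil.
- by rewrite -sa -mulrA -wzM mulgV wz1 mulr1.
- by rewrite -sb -mulrA -wzM mulgV wz1 mulr1.
Qed.

Lemma specD a b a' b' : specializes a b -> specializes a' b' ->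
  specializes (oplus a a') (oplus b b').
Proof.
move=> [s [t [t0 sa sb]]] [s' [t' [t'0 sa' sb']]].
exists (poly_mul s t' ++ poly_mul t s'), (poly_mul t t').
split; first exact: poly_mul_neq0.
  by rewrite poly_atD !poly_atM wzD mulrDr mulrAC sa -mulrA sa'.
by rewrite poly_atD !poly_atM wzD mulrDr mulrAC sb -mulrA sb'.
Qed.

Lemma spec_expz a b m : specializes a b ->
  specializes (expsfz a m) (expsfz b m).
Proof.
move=> ab; have X k : specializes (a ^+ k)%g (b ^+ k)%g.
  elim: k => [|k IH]; first by rewrite !expg0; apply: spec1.
  by rewrite !expgS; apply: specM.
by case: m => k /=; [|apply: specV]; apply: X.
Qed.

(** Two fractions equal at the free u have equal cross products as polynomials,
    so they are equal at y as well. *)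
Lemma spec_fun a b b' : sf_free u ->
  specializes a b -> specializes a b' -> b = b'.
Proof.
move=> fr [s [t [t0 sa sb]]] [s' [t' [t'0 sa' sb']]].
have /fr st : poly_at u (poly_mul s t') = poly_at u (poly_mul s' t).
  by rewrite !poly_atM -sa -sa' mulrAC [RHS]mulrAC [X in X * _ = _]mulrC.
have : poly_at y (poly_mul s t') = poly_at y (poly_mul s' t).
  exact: perm_big.
have [c tc] := poly_atE y t0; have [c' tc'] := poly_atE y t'0.
rewrite !poly_atM -sb -sb' tc tc' mulrAC [RHS]mulrAC [X in _ = X * _]mulrC.
by rewrite -!wzM => /wz_inj/mulgI.
Qed.

End Specialization.

(** The coefficient rule of seed mutation, over any semifield, so that it
    applies both to coefficients and to the yhat variables. *)
Definition y_mut (P : semifieldType) n (k : 'I_n) (B : 'M[int]_n)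
    (y : 'I_n -> P) (j : 'I_n) : P :=
  if j == k then (y k)^-1%g
  else if 0 < B j k
  then (y j * expsfz (y k) (B j k) * expsfz (oplus (y k) 1) (- B j k))%g
  else (y j * expsfz (oplus (y k) 1) (- B j k))%g.

Lemma spec_y_mut (Q P : semifieldType) n (u : 'I_n -> Q) (y : 'I_n -> P) k B
    (a : 'I_n -> Q) (b : 'I_n -> P) :
  (forall j, specializes u y (a j) (b j)) ->
  forall j, specializes u y (y_mut k B a j) (y_mut k B b j).
Proof.
move=> ab j; rewrite /y_mut; case: ifP => _; first exact: specV.
have ab1 : specializes u y (oplus (a k) 1%g) (oplus (b k) 1%g).
  by apply: specD => //; apply: spec1.
by case: ifP => _; repeat apply: specM => //; apply: spec_expz.
Qed.

(** Every vertex is joined to t0 by a path: strip the letters of t0 to reach the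
    empty word, then add those of the target. *)
Lemma tree_ind n (R : tree n -> Prop) (t0 : tree n) :
  R t0 -> (forall t k, R t -> R (nbr k t)) -> forall t, R t.
Proof.
move=> R0 Rn.
have nbr_cons k w (kw : reduced (k :: w)) (rw : reduced w) :
    nbr k (exist _ (k :: w) kw) = exist _ w rw :> tree n.
  by apply: val_inj => /=; rewrite eqxx.
have nil_R : R (exist _ [::] isT).
  case: t0 R0; elim=> [|k w IH] kw Rw.
    by move: Rw; congr R; apply: val_inj.
  have rw : reduced w by case: w kw {IH Rw} => //= j w /andP[].
  by apply: (IH rw); rewrite -(nbr_cons k _ kw); apply: Rn.
case; elim=> [|k w IH] kw.
  by move: nil_R; congr R; apply: val_inj.
have rw : reduced w by case: w kw {IH} => //= j w /andP[].
have := Rn _ k (IH rw); rewrite -(nbr_cons k _ kw rw) nbrK.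
by [].
Qed.

(** Mutation is built from semifield operations, hence commutes with
    specialization of the initial values. *)
Theorem free_y_pattern_universal (Q P : semifieldType) n
    (B : tree n -> 'M[int]_n)
    (u : tree n -> 'I_n -> Q) (y : tree n -> 'I_n -> P) t0 :
  (forall t k j, u (nbr k t) j = y_mut k (B t) (u t) j) ->
  (forall t k j, y (nbr k t) j = y_mut k (B t) (y t) j) ->
  sf_free (u t0) ->
  forall t1 t2 i j, u t1 i = u t2 j -> y t1 i = y t2 j.
Proof.
move=> umut ymut ufree t1 t2 i j E.
have spec t : forall l, specializes (u t0) (y t0) (u t l) (y t l).
  move: t; apply: (tree_ind (t0 := t0)) => [l|t k IH l]; first exact: spec_gen.
  by rewrite umut ymut; apply: spec_y_mut.
apply: (spec_fun ufree (spec t1 i)).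
by rewrite E; apply: spec.
Qed.

(** * Linear independence of Laurent monomials in a free cluster *)

Section GrInj.
Import multinomials.monalg.
Variable P : semifieldType.

Lemma gr_injM (p q : P) : gr_inj (p * q)%g = gr_inj p * gr_inj q.
Proof. by rewrite /gr_inj [RHS]gr_mulUU mulr1. Qed.

Lemma gr_inj1 : gr_inj (1%g : P) = 1.
Proof. by []. Qed.

Lemma gr_inj_neq0 (p : P) : gr_inj p != 0.
Proof. by rewrite [_ == _]monalgU_eq0. Qed.

Lemma sum_gr_inj_count (I : Type) (r : seq I) (a : pred I) (f : I -> P) p :
  mcoeff p (\sum_(i <- r | a i) gr_inj (f i) : {malg int[P]}) =
  (count [pred i | a i && (f i == p)] r)%:R.
Proof.
rewrite raddf_sum -sum1_count natr_sum /= big_mkcondr /=.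
by apply: eq_bigr => i _; rewrite mcoeffU; case: eqP.
Qed.
End GrInj.

Section Ambient.
Import multinomials.mpoly.
Variables (P : semifieldType) (n : nat).

Lemma sf_injM (p q : P) : sf_inj n (p * q)%g = sf_inj n p * sf_inj n q.
Proof. by rewrite /sf_inj /scal gr_injM !rmorphM. Qed.

Lemma sf_inj1 : sf_inj n (1%g : P) = 1.
Proof. by rewrite /sf_inj /scal gr_inj1 !rmorph1. Qed.

Lemma sf_inj_neq0 (p : P) : sf_inj n p != 0.
Proof.
by rewrite /sf_inj /scal tofrac_eq0 mpolyC_eq0 tofrac_eq0 gr_inj_neq0.
Qed.

Lemma sf_injV (p : P) : sf_inj n p^-1%g = (sf_inj n p)^-1.
Proof.
apply: (mulfI (sf_inj_neq0 p)).
by rewrite -sf_injM mulgV sf_inj1 mulfV ?sf_inj_neq0.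
Qed.

Lemma sf_injX (p : P) m : sf_inj n (p ^+ m)%g = sf_inj n p ^+ m.
Proof.
by elim: m => [|m IH]; rewrite ?sf_inj1 // expgS exprS sf_injM IH.
Qed.

Lemma sf_inj_expz (p : P) m : sf_inj n (expsfz p m) = sf_inj n p ^ m.
Proof. by case: m => m /=; rewrite ?sf_injV sf_injX. Qed.

Definition laurent (x : 'I_n -> ambient P n) (a : P * 'rV[int]_n) :
    ambient P n :=
  sf_inj n a.1 * \prod_i x i ^ a.2 0 i.

Variable x : 'I_n -> ambient P n.
Hypothesis x_free : algebraically_independent x.

Let scal_morph : {rmorphism coef_field P -> ambient P n} :=
  @FracField.tofrac {mpoly (coef_field P)[n]} \o @mpolyC n (coef_field P).

Lemma eval_atE (p : {mpoly (coef_field P)[n]}) :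
  eval_at x p = mmap scal_morph x p.
Proof. by []. Qed.

Lemma eval_atB : {morph eval_at x : p q / p - q}.
Proof. by move=> p q; rewrite !eval_atE raddfB. Qed.

Lemma alg_indep_neq0 i : x i != 0.
Proof.
apply/eqP => xi0; have /x_free : eval_at x 'X_i = 0.
  by rewrite eval_atE mmapX mmap1U.
move/(congr1 (mcoeff U_(i)))/eqP.
by rewrite mcoeffXU eqxx mcoeff0 oner_eq0.
Qed.

(** A common monomial factor clears the negative exponents; algebraic
    independence of x then turns the equality into one of polynomials.  Its
    coefficient at a given exponent is an identity in the group ring, where the
    coefficient at p counts the occurrences of p. *)
Lemma laurent_indep (s s' : seq (P * 'rV[int]_n)) :
  \sum_(a <- s) laurent x a = \sum_(a <- s') laurent x a -> perm_eq s s'.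
Proof.
pose N := (\max_(a <- s ++ s') \max_i `|a.2 0%R i|)%N.
have le_N (a : P * 'rV[int]_n) i : a \in s ++ s' -> (`|a.2 0%R i| <= N)%N.
  move=> as'; apply: leq_trans (leq_bigmax_seq _ as' isT).
  exact: (@leq_bigmax _ (fun j => `|a.2 0%R j|%N)).
have ge0 (a : P * 'rV[int]_n) i : a \in s ++ s' -> 0 <= a.2 0 i + N%:Z.
  by move=> /(le_N a i); lia.
pose shift (v : 'rV[int]_n) := [multinom absz (v 0 i + N%:Z)%R | i < n].
pose poly t := \sum_(a <- t)
  FracField.tofrac (gr_inj a.1) *: 'X_[shift a.2] : {mpoly (coef_field P)[n]}.
have poly_eval t : {subset t <= s ++ s'} ->
    eval_at x (poly t) = \prod_i x i ^+ N * \sum_(a <- t) laurent x a.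
  move=> sub; rewrite eval_atE raddf_sum big_distrr /=.
  apply: eq_big_seq => a /sub as'.
  rewrite mmapZ mmapX /laurent mulrCA; congr (_ * _).
  rewrite -big_split /mmap1; apply: eq_bigr => i _ /=.
  rewrite mnmE -[x i ^+ `|_|]/(x i ^ (Posz `|_|)) gez0_abs ?ge0 //.
  by rewrite expfzDr ?alg_indep_neq0 // mulrC.
have subl : {subset s <= s ++ s'} by move=> a; rewrite mem_cat => ->.
have subr : {subset s' <= s ++ s'} by move=> a; rewrite mem_cat orbC => ->.
move=> sum_eq; have poly_eq : poly s = poly s'.
  apply/eqP; rewrite -subr_eq0; apply/eqP/x_free.
  by rewrite eval_atB !poly_eval // sum_eq subrr.
apply/allP => a as'; apply/eqP.
have coefE t : (poly t)@_(shift a.2) = FracField.tofrac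
    (\sum_(b <- t | shift b.2 == shift a.2) gr_inj b.1).
  rewrite /poly raddf_sum raddf_sum [RHS]big_mkcond; apply: eq_bigr => b _ /=.
  by rewrite mcoeffZ mcoeffX; case: eqP; rewrite ?mulr1 ?mulr0.
have countE t : {subset t <= s ++ s'} -> count_mem a t =
    count [pred b | (shift b.2 == shift a.2) && (b.1 == a.1)] t.
  move=> sub; apply: eq_in_count => b /sub bs' /=; apply/eqP/andP => [->|[]] //.
  move=> /eqP/mnmP E /eqP E1.
  rewrite [b]surjective_pairing [a]surjective_pairing.
  congr (_, _) => //; apply/rowP => i; have := E i; rewrite !mnmE.
  have := ge0 _ i as'; have := ge0 _ i bs'.
  move: (a.2 0 i) (b.2 0 i) => p q; lia.
rewrite !countE //; apply/eqP; rewrite -(eqr_nat int) -!sum_gr_inj_count.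
move: poly_eq => /(congr1 (mcoeff (shift a.2)))/eqP.
by rewrite !coefE tofrac_eq => /eqP ->.
Qed.
End Ambient.

(** * Semifields inside fields *)

(** Closed like the positive elements of an ordered field: such a set is a
    semifield under the operations of the field. *)
Record pos_cone (K : fieldType) := PosCone {
  in_cone : K -> Prop;
  cone1 : in_cone 1;
  coneD : forall f g, in_cone f -> in_cone g -> in_cone (f + g);
  coneM : forall f g, in_cone f -> in_cone g -> in_cone (f * g);
  coneV : forall f, in_cone f -> in_cone f^-1;
  cone_neq0 : forall f, in_cone f -> f != 0
}.

Section ConeSemifield.
Variables (K : fieldType) (C : pos_cone K).

Lemma coneX f m : in_cone C f -> in_cone C (f ^+ m).
Proof.
move=> Cf; elim: m => [|m IH]; first by rewrite expr0; apply: cone1.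
by rewrite exprS; apply: coneM.
Qed.

Lemma coneXz f (m : int) : in_cone C f -> in_cone C (f ^ m).
Proof. by case: m => m Cf; [|apply: coneV]; apply: coneX. Qed.

Lemma cone_prod (I : finType) (Q : pred I) (f : I -> K) :
  (forall i, Q i -> in_cone C (f i)) -> in_cone C (\prod_(i | Q i) f i).
Proof.
by move=> Cf; elim/big_ind: _ => //; [apply: cone1|apply: coneM].
Qed.

(** Otherwise f - 1 is a nonzero factor of f ^ m.+1 - 1 = 0, and the cofactor
    1 + f + ... + f ^ m vanishes although it is positive. *)
Lemma cone_torsion_free f m : in_cone C f -> f ^+ m.+1 = 1 -> f = 1.
Proof.
move=> Cf /eqP; rewrite -subr_eq0 subrX1 mulf_eq0 subr_eq0.
case/orP => [/eqP //|]; apply: contraTeq => _; apply: (@cone_neq0 _ C).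
elim: m => [|m IH]; first by rewrite big_ord1 expr0; apply: cone1.
by rewrite big_ord_recr /=; apply: coneD => //; apply: coneX.
Qed.

Definition cone_sf : Type := {f : K | `[< in_cone C f >]}.

HB.instance Definition _ := Choice.on cone_sf.

Lemma cone_sfP (a : cone_sf) : in_cone C (sval a).
Proof. by case: a => f /= /asboolP. Qed.

Definition to_cone f (Cf : in_cone C f) : cone_sf := exist _ f (asboolT Cf).

Definition cone_one := to_cone (cone1 C).
Definition cone_mul a b := to_cone (coneM (cone_sfP a) (cone_sfP b)).
Definition cone_add a b := to_cone (coneD (cone_sfP a) (cone_sfP b)).
Definition cone_inv a := to_cone (coneV (cone_sfP a)).

Lemma cone_mulA : associative cone_mul.
Proof. by move=> a b c; apply: val_inj; rewrite /= mulrA. Qed.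

Lemma cone_mul1 : left_id cone_one cone_mul.
Proof. by move=> a; apply: val_inj; rewrite /= mul1r. Qed.

Lemma cone_mulC : commutative cone_mul.
Proof. by move=> a b; apply: val_inj; rewrite /= mulrC. Qed.

Lemma cone_mul1r : right_id cone_one cone_mul.
Proof. by move=> a; rewrite cone_mulC cone_mul1. Qed.

Lemma cone_mulV : left_inverse cone_one cone_inv cone_mul.
Proof.
by move=> a; apply: val_inj; rewrite /= mulVf // (cone_neq0 (cone_sfP a)).
Qed.

Lemma cone_mulVr : right_inverse cone_one cone_inv cone_mul.
Proof. by move=> a; rewrite cone_mulC cone_mulV. Qed.

HB.instance Definition _ := isGroup.Build cone_sf
  cone_mulA cone_mul1 cone_mul1r cone_mulV cone_mulVr.

Lemma val_coneX (a : cone_sf) m : sval (a ^+ m)%g = sval a ^+ m.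
Proof. by elim: m => [//|m IH]; rewrite expgS exprS -IH. Qed.

Lemma cone_sf_torsion_free (a : cone_sf) m : (a ^+ m.+1)%g = 1%g -> a = 1%g.
Proof.
move=> /(congr1 sval); rewrite val_coneX.
by move=> /(cone_torsion_free (cone_sfP a)) a1; apply: val_inj.
Qed.

Lemma cone_addC : commutative cone_add.
Proof. by move=> a b; apply: val_inj; rewrite /= addrC. Qed.

Lemma cone_addA : associative cone_add.
Proof. by move=> a b c; apply: val_inj; rewrite /= addrA. Qed.

Lemma cone_mulDl :
  left_distributive (fun a b : cone_sf => (a * b)%g) cone_add.
Proof. by move=> a b c; apply: val_inj; rewrite /= mulrDl. Qed.

HB.instance Definition _ := isSemifield.Build cone_sf
  cone_mulC cone_sf_torsion_free cone_addC cone_addA cone_mulDl.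

Lemma cone_sf_inj (a b : cone_sf) : sval a = sval b -> a = b.
Proof. exact: val_inj. Qed.

Lemma val_coneM (a b : cone_sf) : sval (a * b)%g = sval a * sval b.
Proof. by []. Qed.

Lemma val_coneD (a b : cone_sf) : sval (oplus a b) = sval a + sval b.
Proof. by []. Qed.

Lemma val_expsfz (a : cone_sf) m : sval (expsfz a m) = sval a ^ m.
Proof. by case: m => m /=; rewrite val_coneX. Qed.

Definition wz_val (u : with_zero cone_sf) : K :=
  if u is Some a then sval a else 0.

Lemma wz_valD u v : wz_val (u + v) = wz_val u + wz_val v.
Proof. by case: u v => [a|] [b|] //=; rewrite ?addr0 ?add0r. Qed.

Lemma wz_valM u v : wz_val (u * v) = wz_val u * wz_val v.
Proof. by case: u v => [a|] [b|] //=; rewrite ?mulr0 ?mul0r. Qed.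

Lemma wz_valX u m : wz_val (u ^+ m) = wz_val u ^+ m.
Proof. by elim: m => [//|m IH]; rewrite !exprS wz_valM IH. Qed.

Lemma wz_val_poly_at n (u : 'I_n -> cone_sf) s :
  wz_val (poly_at u s) = \sum_(m <- s) \prod_i sval (u i) ^+ m 0 i.
Proof.
rewrite /poly_at (big_morph wz_val wz_valD (erefl _)); apply: eq_bigr => m _.
rewrite /monom_at (big_morph wz_val wz_valM (erefl _)); apply: eq_bigr => i _.
by rewrite wz_valX.
Qed.

End ConeSemifield.

(** * The positive elements of the ambient field *)

Section LaurentCone.
Variables (P : semifieldType) (n : nat) (x : 'I_n -> ambient P n).
Hypothesis x_free : algebraically_independent x.
Implicit Types s t : seq (P * 'rV[int]_n).

Definition laurent_sum s := \sum_(a <- s) laurent x a.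

Definition laurent_ratio (f : ambient P n) := exists s t,
  [/\ s != [::], t != [::] & f = laurent_sum s / laurent_sum t].

Lemma laurentM a b :
  laurent x ((a.1 * b.1)%g, a.2 + b.2) = laurent x a * laurent x b.
Proof.
rewrite /laurent /= sf_injM mulrACA -big_split; congr (_ * _).
by apply: eq_bigr => i _; rewrite mxE expfzDr ?alg_indep_neq0.
Qed.

Lemma laurent1 : laurent x (1%g, 0) = 1.
Proof.
by rewrite /laurent sf_inj1 mul1r big1 // => i _; rewrite mxE expr0z.
Qed.

Lemma laurent_sumM s t :
  exists2 r, laurent_sum s * laurent_sum t = laurent_sum r &
  s != [::] -> t != [::] -> r != [::].
Proof.
exists [seq ((a.1 * b.1)%g, a.2 + b.2) | a <- s, b <- t].
  rewrite /laurent_sum big_allpairs_dep big_distrl /=; apply: eq_bigr => a _.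
  by rewrite big_distrr /=; apply: eq_bigr => b _; rewrite laurentM.
by case: s => // a s; case: t.
Qed.

Lemma laurent_sumD s t : laurent_sum s + laurent_sum t = laurent_sum (s ++ t).
Proof. by rewrite /laurent_sum big_cat. Qed.

(** Independence applied to a sum of monomials and the empty sum. *)
Lemma laurent_sum_neq0 s : s != [::] -> laurent_sum s != 0.
Proof.
apply: contra_neq => s0; apply/perm_nilP.
by apply: (laurent_indep x_free); rewrite big_nil.
Qed.

Lemma laurent_ratio_laurent a : laurent_ratio (laurent x a).
Proof.
exists [:: a], [:: (1%g, 0)]; split=> //.
by rewrite /laurent_sum !big_seq1 laurent1 divr1.
Qed.

Lemma laurent_ratio1 : laurent_ratio 1.
Proof. by rewrite -laurent1; apply: laurent_ratio_laurent. Qed.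

Lemma laurent_ratioM f g :
  laurent_ratio f -> laurent_ratio g -> laurent_ratio (f * g).
Proof.
move=> [s [t [s0 t0 ->]]] [s' [t' [s'0 t'0 ->]]].
have [r rE r0] := laurent_sumM s s'; have [q qE q0] := laurent_sumM t t'.
by exists r, q; rewrite r0 ?q0 // -rE -qE mulf_div.
Qed.

Lemma laurent_ratioV f : laurent_ratio f -> laurent_ratio f^-1.
Proof. by move=> [s [t [s0 t0 ->]]]; exists t, s; rewrite invf_div. Qed.

Lemma laurent_ratioD f g :
  laurent_ratio f -> laurent_ratio g -> laurent_ratio (f + g).
Proof.
move=> [s [t [s0 t0 ->]]] [s' [t' [s'0 t'0 ->]]].
have [r rE r0] := laurent_sumM s t'; have [q qE q0] := laurent_sumM s' t.
have [p pE p0] := laurent_sumM t t'.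
exists (r ++ q), p; rewrite p0 // -laurent_sumD -rE -qE -pE.
rewrite addf_div ?laurent_sum_neq0 //; split=> //.
by case: r r0 {rE} => // r0; have := r0 s0 t'0.
Qed.

Lemma laurent_ratio_neq0 f : laurent_ratio f -> f != 0.
Proof.
by move=> [s [t [s0 t0 ->]]]; rewrite mulf_neq0 ?invr_eq0 ?laurent_sum_neq0.
Qed.

Definition laurent_cone : pos_cone (ambient P n) :=
  PosCone laurent_ratio1 laurent_ratioD laurent_ratioM laurent_ratioV
    laurent_ratio_neq0.

Lemma laurent_cone_sf_inj p : in_cone laurent_cone (sf_inj n p).
Proof.
have := laurent_ratio_laurent (p, 0); rewrite /laurent big1 ?mulr1 // => i _.
by rewrite mxE expr0z.
Qed.

Lemma laurent_cone_var i : in_cone laurent_cone (x i).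
Proof.
have := laurent_ratio_laurent (1%g, \row_j (j == i)%:Z).
rewrite /laurent sf_inj1 mul1r (bigD1 i) //= mxE eqxx expr1z big1 ?mulr1 //.
by move=> j /negPf ji; rewrite mxE ji expr0z.
Qed.

Lemma laurent_expn a m : laurent x a ^+ m = laurent x ((a.1 ^+ m)%g, a.2 *+ m).
Proof.
elim: m => [|m IH]; first by rewrite expg0 mulr0n laurent1.
by rewrite exprS IH expgS mulrS -laurentM.
Qed.

Lemma laurent_prod (a : 'I_n -> P * 'rV[int]_n) (r : seq 'I_n) : exists p,
  \prod_(i <- r) laurent x (a i) = laurent x (p, \sum_(i <- r) (a i).2).
Proof.
elim: r => [|i r [p IH]]; first by exists 1%g; rewrite !big_nil laurent1.
by exists ((a i).1 * p)%g; rewrite !big_cons IH -laurentM.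
Qed.

(** A monomial in the u_j with exponent m is, up to a coefficient in P, the
    Laurent monomial in x with exponent m B.  Since det B <> 0 the exponent m can be
    recovered, so independence of Laurent monomials gives freeness. *)
Lemma laurent_sf_free (B : 'M[int]_n) (y : 'I_n -> P)
    (u : 'I_n -> cone_sf laurent_cone) :
  \det B != 0 -> (forall j, sval (u j) = laurent x (y j, row j B)) -> sf_free u.
Proof.
move=> detB uE s t /(congr1 (@wz_val _ _)); rewrite !wz_val_poly_at.
have monomE (m : 'rV[nat]_n) : exists p, \prod_i sval (u i) ^+ m 0 i =
    laurent x (p, map_mx Posz m *m B).
  have [p pE] := laurent_prod
    (fun i => ((y i ^+ m 0%R i)%g, row i B *+ m 0%R i)) (index_enum 'I_n).
  exists p; have vE : \sum_i (row i B *+ m 0%R i) = map_mx Posz m *m B.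
    rewrite mulmx_sum_row; apply: eq_bigr => i _.
    by rewrite mxE -scaler_nat natz.
  rewrite -vE; apply: etrans pE; apply: eq_bigr => i _.
  by rewrite uE laurent_expn.
pose g m : P * 'rV[int]_n := (projT1 (cid (monomE m)), map_mx Posz m *m B).
have gE (m : 'rV[nat]_n) : \prod_i sval (u i) ^+ m 0 i = laurent x (g m).
  exact: (projT2 (cid (monomE m))).
(* Multiplying by the adjugate recovers det B times the exponent. *)
have g_inj : injective g.
  move=> m m' [_ /eqP]; rewrite -subr_eq0 -mulmxBl => /eqP E.
  have : (map_mx Posz m - map_mx Posz m') *m B *m \adj B = 0.
    by rewrite E mul0mx.
  rewrite -mulmxA mul_mx_adj mul_mx_scalar => /rowP mm.
  apply/rowP => i; have /eqP := mm i.
  by rewrite !mxE mulf_eq0 (negPf detB) subr_eq0 => /eqP [].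
have sumE (r : seq 'rV[nat]_n) : \sum_(m <- r) \prod_i sval (u i) ^+ m 0 i =
    \sum_(a <- map g r) laurent x a.
  by rewrite big_map; apply: eq_bigr => m _; apply: gE.
rewrite !sumE => /(laurent_indep x_free).
exact: perm_map_inj.
Qed.

End LaurentCone.

(** * Mutation of exchange matrices *)

(** When b_kk = 0, mutation turns B into E B F, with two involutions E and F that
    differ from the identity only in column k, resp. row k.  This makes
    nondegeneracy evident; and since D E = F^T D for a skew-symmetrizer D, the
    mutated matrix satisfies D (E B F) = F^T (D B) F, which is
    skew-symmetric. *)
Section MatrixMutation.
Variables (n : nat) (k : 'I_n) (B : 'M[int]_n).

Definition mut_row_op : 'M[int]_n := \matrix_(i, j)
  if j == k then if i == k then -1 else Num.max (- B i k) 0 else (i == j)%:R.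

Definition mut_col_op : 'M[int]_n := \matrix_(i, j)
  if i == k then if j == k then -1 else Num.max (B k j) 0 else (i == j)%:R.

Lemma mut_row_opE (M : 'M[int]_n) i j : (mut_row_op *m M) i j =
  if i == k then - M k j else M i j + Num.max (- B i k) 0 * M k j.
Proof.
rewrite mxE (bigD1 k) //= !mxE eqxx; case: (eqVneq i k) => [->|ik].
  rewrite mulN1r big1 ?addr0 // => l /negPf lk.
  by rewrite mxE lk eq_sym lk mul0r.
rewrite addrC (bigD1 i) //= mxE (negPf ik) eqxx mul1r big1 ?addr0 //.
by move=> l /andP[/negPf lk /negPf li]; rewrite mxE lk eq_sym li mul0r.
Qed.

Lemma mut_col_opE (M : 'M[int]_n) i j : (M *m mut_col_op) i j =
  if j == k then - M i k else M i j + M i k * Num.max (B k j) 0.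
Proof.
rewrite mxE (bigD1 k) //= !mxE eqxx; case: (eqVneq j k) => [->|jk].
  by rewrite mulrN1 big1 ?addr0 // => l /negPf lk; rewrite mxE lk mulr0.
rewrite addrC (bigD1 j) //= mxE (negPf jk) eqxx mulr1 big1 ?addr0 //.
by move=> l /andP[/negPf lk /negPf lj]; rewrite mxE lk lj mulr0.
Qed.

Lemma mut_row_opK : mut_row_op *m mut_row_op = 1%:M.
Proof.
apply/matrixP => i j; rewrite mut_row_opE !mxE eqxx.
case: (eqVneq i k) => [->|ik].
  by case: (eqVneq j k); rewrite ?opprK ?oppr0.
case: (eqVneq j k) => [->|jk]; first by rewrite mulrN1 subrr (negPf ik).
by rewrite mulr0 addr0.
Qed.

Lemma mut_col_opK : mut_col_op *m mut_col_op = 1%:M.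
Proof.
apply/matrixP => i j; rewrite mut_col_opE !mxE eqxx.
case: (eqVneq j k) => [->|jk].
  by case: (eqVneq i k); rewrite ?opprK ?oppr0.
case: (eqVneq i k) => [->|ik].
  by rewrite mulN1r subrr [k == j]eq_sym (negPf jk).
by rewrite mul0r addr0.
Qed.

(** Half of |a| b + a |b| is ab, - ab or 0 according to the signs. *)
Lemma mut_entryE (a b : int) : ((`|a| * b + a * `|b|) %/ 2)%Z =
  Num.max (- a) 0 * b + a * Num.max b 0.
Proof.
suff -> : `|a| * b + a * `|b| = (Num.max (- a) 0 * b + a * Num.max b 0) * 2.
  by rewrite mulzK.
case: (ger0P a) => ha; case: (ger0P b) => hb; nia.
Qed.

Lemma mut_mxE (P : semifieldType) (S : seed P n) : exchange_mx S = B ->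
  B k k = 0 -> mut_mx k S = mut_row_op *m B *m mut_col_op.
Proof.
move=> SB Bkk; apply/matrixP => i j.
rewrite mut_col_opE !mut_row_opE mxE SB.
case: (eqVneq j k) => [->|jk]; case: (eqVneq i k) => [->|ik] //=.
- by rewrite Bkk oppr0.
- by rewrite Bkk mulr0 addr0.
- by rewrite Bkk oppr0 mul0r addr0.
- by rewrite Bkk mulr0 addr0 mut_entryE addrA.
Qed.

Lemma skewP : skew_symmetrizable B -> exists2 d : 'rV[int]_n,
  forall i, 0 < d 0 i & forall i j, d 0 i * B i j = - (d 0 j * B j i).
Proof.
move=> [d [d0 dB]]; exists d => // i j.
by have := congr1 (fun M : 'M_n => M j i) dB; rewrite mul_diag_mx !mxE.
Qed.

Lemma skew_diag i : skew_symmetrizable B -> B i i = 0.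
Proof.
move=> /skewP[d d0 dB]; have := dB i i; have := d0 i.
move: (d 0 i) (B i i) => p q; nia.
Qed.

Lemma det_involution (M : 'M[int]_n) : M *m M = 1%:M -> \det M != 0.
Proof.
move=> /(congr1 determinant); rewrite det_mulmx det1 => M1.
by apply/eqP => M0; move: M1; rewrite M0 mul0r.
Qed.

Lemma mut_mx_det (P : semifieldType) (S : seed P n) : exchange_mx S = B ->
  skew_symmetrizable B -> \det B != 0 -> \det (mut_mx k S) != 0.
Proof.
move=> SB /(skew_diag k) Bkk detB; rewrite (mut_mxE SB Bkk) !det_mulmx.
by rewrite !mulf_neq0 // det_involution // (mut_row_opK, mut_col_opK).
Qed.

Lemma mut_mx_skew (P : semifieldType) (S : seed P n) : exchange_mx S = B ->
  skew_symmetrizable B -> skew_symmetrizable (mut_mx k S).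
Proof.
move=> SB skB; have Bkk := skew_diag k skB.
have [d [d0 dB]] := skB; exists d; split=> //; rewrite (mut_mxE SB Bkk).
have dBk i : d 0 i * B i k = - (d 0 k * B k i).
  by have := congr1 (fun M : 'M_n => M k i) dB; rewrite mul_diag_mx !mxE.
have rowcol : diag_mx d *m mut_row_op = mut_col_op^T *m diag_mx d.
  apply/matrixP => i j; rewrite mul_diag_mx mul_mx_diag !mxE.
  case: (eqVneq j k) => [->|jk]; case: (eqVneq i k) => [->|ik].
  - by rewrite mulrC.
  - move: (d0 i) (d0 k) (dBk i).
    by move: (d 0 i) (d 0 k) (B i k) (B k i) => p q r s; nia.
  - by rewrite eq_sym (negPf jk) mulr0 mul0r.
  - rewrite [j == i]eq_sym; case: (eqVneq i j) => [->|ij].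
      by rewrite mulr1 mul1r.
    by rewrite mulr0 mul0r.
have -> : diag_mx d *m (mut_row_op *m B *m mut_col_op) =
    mut_col_op^T *m (diag_mx d *m B) *m mut_col_op by rewrite !mulmxA rowcol.
rewrite trmx_mul [(mut_col_op^T *m _)^T]trmx_mul dB trmxK.
by rewrite mulNmx mulmxN mulmxA.
Qed.
End MatrixMutation.

(** * Mutation of the yhat variables *)

(** The computation behind [yhat_mutation] in an arbitrary field.  Here y and c
    stand for y_k and y_k (+) 1, Y for yhat_k, and x', B' for the mutated
    cluster and matrix; yj is y_j.  With Mp and Mm the two monomials of the exchange
    relation, Y = y Mp / Mm, so that the new variable is
    x'_k = Mm (Y + 1) / (c x_k). *)
Section ExchangeAlgebra.
Variables (K : fieldType) (n : nat) (k : 'I_n) (B : 'M[int]_n).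
Variables (x : 'I_n -> K) (y c : K).
Hypothesis Bkk : B k k = 0.
Hypothesis x_neq0 : forall i, x i != 0.
Hypothesis c_neq0 : c != 0.

Lemma prod_exprz (I : finType) (Q : pred I) (f : I -> K) m :
  (\prod_(i | Q i) f i) ^ m = \prod_(i | Q i) f i ^ m.
Proof. by elim/big_rec2: _ => [|i a b _ <-]; rewrite ?exp1rz ?expfzMl. Qed.

Let Mp := \prod_i x i ^ Num.max (B k i) 0.
Let Mm := \prod_i x i ^ Num.max (- B k i) 0.

Let Mm_neq0 : Mm != 0.
Proof. by apply/prodf_neq0 => i _; rewrite expfz_neq0. Qed.

Let Y := y * \prod_i x i ^ B k i.

Let Y_ratio : Y = y * Mp / Mm.
Proof.
rewrite /Y -mulrA; congr (_ * _).
apply: (mulIf Mm_neq0); rewrite divfK // -big_split; apply: eq_bigr => i _ /=.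
by rewrite -expfzDr //; congr (_ ^ _); lia.
Qed.

Lemma exchange_factor :
  y / c * \prod_(i | 0 < B k i) x i ^ B k i +
    c^-1 * \prod_(i | B k i < 0) x i ^ (- B k i) = Mm * (Y + 1) / c.
Proof.
have -> : \prod_(i | 0 < B k i) x i ^ B k i = Mp.
  rewrite big_mkcond; apply: eq_bigr => i _ /=.
  by case: (ltrP 0 (B k i)).
have -> : \prod_(i | B k i < 0) x i ^ (- B k i) = Mm.
  rewrite big_mkcond; apply: eq_bigr => i _ /=; rewrite -oppr_gt0.
  by case: (ltrP 0 (- B k i)).
by rewrite Y_ratio; field; rewrite c_neq0 Mm_neq0.
Qed.

Lemma prod_neq_k (b : 'I_n -> int) (e : int) (q : 'I_n -> int) : q k = 0 ->
  \prod_(i | i != k) x i ^ (b i + e * q i) =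
  (\prod_i x i ^ b i) * x k ^ (- b k) * (\prod_i x i ^ q i) ^ e.
Proof.
move=> qk; rewrite [\prod_i x i ^ b i](bigD1 k) //=.
rewrite [X in X * _ ^ e]mulrAC -expfzDr // subrr expr0z mul1r.
rewrite [\prod_i x i ^ q i](bigD1 k) //= qk expr0z mul1r.
rewrite prod_exprz -big_split; apply: eq_bigr => i _ /=.
by rewrite expfzDr // exprz_exp [q i * e]mulrC.
Qed.

Variables (j : 'I_n) (yj : K) (x' : 'I_n -> K) (B' : 'M[int]_n).
Hypothesis x'E : forall i, i != k -> x' i = x i.
Hypothesis x'k : x' k = (y / c * \prod_(i | 0 < B k i) x i ^ B k i +
    c^-1 * \prod_(i | B k i < 0) x i ^ (- B k i)) / x k.
Hypothesis B'k : B' j k = - B j k.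
Hypothesis B'E : forall i, i != k ->
  B' j i = B j i + ((`|B j k| * B k i + B j k * `|B k i|) %/ 2)%Z.
Hypothesis Y1_neq0 : Y + 1 != 0.

(* Off k the exponents of x in row j change by b_jk q, where q is the exponent
   of one of the two exchange monomials, chosen by the sign of b_jk. *)
Let prod_mut q : q k = 0 ->
  (forall i, i != k -> B' j i = B j i + B j k * q i) ->
  \prod_i x' i ^ B' j i = (\prod_i x i ^ B j i) *
    (c / (Mm * (Y + 1)) * \prod_i x i ^ q i) ^ B j k.
Proof.
move=> qk B'q; rewrite (bigD1 k) //= x'k exchange_factor B'k.
under eq_bigr => i ik do rewrite x'E // B'q //.
rewrite prod_neq_k // -[_ * _ ^ B j k]mulrA mulrCA; congr (_ * _).
rewrite -!exprz_inv -!expfzMl; congr (_ ^ _).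
by field; rewrite Y1_neq0 Mm_neq0 x_neq0 c_neq0.
Qed.

Lemma yhat_mut_pos : 0 < B j k ->
  yj * y ^ B j k * c ^ (- B j k) * \prod_i x' i ^ B' j i =
  yj * (\prod_i x i ^ B j i) * Y ^ B j k * (Y + 1) ^ (- B j k).
Proof.
move=> Bjk; rewrite (prod_mut (q := fun i => Num.max (B k i) 0)).
- rewrite -/Mp -!exprz_inv.
  have -> : Y ^ B j k = (y * Mp / Mm) ^ B j k by rewrite Y_ratio.
  transitivity (yj * (\prod_i x i ^ B j i) *
      (y / c * (c / (Mm * (Y + 1)) * Mp)) ^ B j k).
    by rewrite !expfzMl; ring.
  rewrite -[RHS]mulrA -expfzMl; congr (_ * _ ^ _).
  by field; rewrite Y1_neq0 Mm_neq0 c_neq0.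
- by rewrite Bkk.
- by move=> i ik; rewrite B'E // mut_entryE; nia.
Qed.

Lemma yhat_mut_neg : ~~ (0 < B j k) ->
  yj * c ^ (- B j k) * \prod_i x' i ^ B' j i =
  yj * (\prod_i x i ^ B j i) * (Y + 1) ^ (- B j k).
Proof.
move=> Bjk; rewrite (prod_mut (q := fun i => Num.max (- B k i) 0)).
- rewrite -/Mm -!exprz_inv mulrACA -expfzMl; congr (_ * _ ^ _).
  by field; rewrite Y1_neq0 Mm_neq0 c_neq0.
- by rewrite Bkk.
- by move=> i ik; rewrite B'E // mut_entryE; nia.
Qed.

End ExchangeAlgebra.

Section YHat.
Variables (P : semifieldType) (n : nat).
Implicit Types S : seed P n.

Definition yhat S (j : 'I_n) : ambient P n :=
  sf_inj n (coeffs S j) * \prod_i cluster S i ^ exchange_mx S j i.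

Lemma exchange_rhsE k S : exchange_rhs k S =
  sf_inj n (coeffs S k) / sf_inj n (oplus (coeffs S k) 1%g) *
    \prod_(i | 0 < exchange_mx S k i) cluster S i ^ exchange_mx S k i +
  (sf_inj n (oplus (coeffs S k) 1%g))^-1 *
    \prod_(i | exchange_mx S k i < 0) cluster S i ^ (- exchange_mx S k i).
Proof. by rewrite /exchange_rhs sf_injM sf_injV. Qed.

(** The factors y_k (+) 1 of the exchange relation and of the coefficient rule
    cancel, leaving the coefficient rule with + for (+). *)
Lemma yhat_mutation k S j : exchange_mx S k k = 0 ->
  (forall i, cluster S i != 0) -> yhat S k + 1 != 0 ->
  yhat (mutation k S) j =
  if j == k then (yhat S k)^-1
  else if 0 < exchange_mx S j k
  then yhat S j * yhat S k ^ exchange_mx S j k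
         * (yhat S k + 1) ^ (- exchange_mx S j k)
  else yhat S j * (yhat S k + 1) ^ (- exchange_mx S j k).
Proof.
move=> Bkk x0 Y1; case: (eqVneq j k) => [->|jk].
  rewrite /yhat /= ffunE eqxx invfM sf_injV; congr (_ * _).
  rewrite -prodfV; apply: eq_bigr => i _.
  rewrite ffunE mxE eqxx /= invr_expz.
  by case: (eqVneq i k) => [->|//]; rewrite Bkk oppr0 !expr0z.
have c0 := sf_inj_neq0 n (oplus (coeffs S k) 1%g).
have x'E i : i != k -> cluster (mutation k S) i = cluster S i.
  by rewrite ffunE => /negPf ->.
have x'k : cluster (mutation k S) k = exchange_rhs k S / cluster S k.
  by rewrite ffunE eqxx.
have B'k : exchange_mx (mutation k S) j k = - exchange_mx S j k.
  by rewrite mxE eqxx orbT.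
have B'E i : i != k -> exchange_mx (mutation k S) j i = exchange_mx S j i +
    ((`|exchange_mx S j k| * exchange_mx S k i +
      exchange_mx S j k * `|exchange_mx S k i|) %/ 2)%Z.
  by rewrite mxE (negPf jk) => /negPf ->.
rewrite exchange_rhsE in x'k; rewrite {1}/yhat.
have -> : coeffs (mutation k S) j = y_mut k (exchange_mx S) (coeffs S) j.
  by rewrite ffunE.
rewrite /y_mut (negPf jk); case: ifPn => Bjk.
  rewrite !sf_injM !sf_inj_expz.
exact: (@yhat_mut_pos _ _ _ _ _ _ _ Bkk x0 c0 _ _ _ _ x'E x'k B'k B'E Y1 Bjk).
rewrite !sf_injM !sf_inj_expz.
exact: (@yhat_mut_neg _ _ _ _ _ _ _ Bkk x0 c0 _ _ _ _ x'E x'k B'k B'E Y1 Bjk).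
Qed.
End YHat.

Lemma expfz_sum (K : fieldType) (I : finType) (f : K) (m : I -> int) :
  f != 0 -> f ^ (\sum_i m i) = \prod_i f ^ m i.
Proof.
move=> f0; apply: (big_morph (fun e : int => f ^ e)) => // a b.
exact: expfzDr.
Qed.

Lemma cone_torsion_free_int (K : fieldType) (C : pos_cone K) f (m : int) :
  in_cone C f -> m != 0 -> f ^ m = 1 -> f = 1.
Proof.
move=> Cf; case: m => [[//|m]|m] _; first exact: (cone_torsion_free Cf).
move/eqP; rewrite NegzE -exprz_inv -exprnP exprVn invr_eq1 => /eqP.
exact: (cone_torsion_free Cf).
Qed.

(** Raising the j-th equation to the entry (l, j) of the adjugate and
    multiplying over j leaves z_l ^ det M = 1; torsion-freeness concludes. *)
Lemma monomial_map_injective (K : fieldType) (C : pos_cone K) n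
    (M : 'M[int]_n) (z : 'I_n -> K) :
  \det M != 0 -> (forall i, in_cone C (z i)) ->
  (forall j, \prod_i z i ^ M j i = 1) -> forall i, z i = 1.
Proof.
move=> detM zC zM l; apply: (cone_torsion_free_int (zC l) detM).
have z0 i : z i != 0 by apply: (cone_neq0 (zC i)).
have powE : \prod_j (\prod_i z i ^ M j i) ^ (\adj M) l j =
    \prod_i z i ^ (\adj M *m M) l i.
  under eq_bigr do rewrite prod_exprz.
  rewrite exchange_big; apply: eq_bigr => i _ /=.
  rewrite mxE expfz_sum //; apply: eq_bigr => j _.
  by rewrite exprz_exp mulrC.
have : \prod_j (\prod_i z i ^ M j i) ^ (\adj M) l j = 1.
  by rewrite big1 // => j _; rewrite zM exp1rz.
rewrite powE mul_adj_mx (bigD1 l) //= !mxE eqxx mulr1n big1 ?mulr1 // => i il.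
by rewrite mxE eq_sym (negPf il) expr0z.
Qed.

(** * Seed patterns *)

Section Pattern.
Variables (P : semifieldType) (n : nat) (B : 'M[int]_n) (t0 : tree n).
Variable Sigma : tree n -> seed P n.
Hypothesis B_skew : skew_symmetrizable B.
Hypothesis B_nondeg : \det B != 0.
Hypothesis Sigma_pattern : seed_pattern B t0 Sigma.

Let Sigma_mut t k : Sigma (nbr k t) = mutation k (Sigma t).
Proof. by case: Sigma_pattern. Qed.

Let B0 : exchange_mx (Sigma t0) = B.
Proof. by case: Sigma_pattern. Qed.

Lemma pattern_free : algebraically_independent (cluster (Sigma t0)).
Proof. by case: Sigma_pattern => [[[]]]. Qed.

Definition pattern_cone := laurent_cone pattern_free.

Lemma pattern_mx t : skew_symmetrizable (exchange_mx (Sigma t)) /\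
  \det (exchange_mx (Sigma t)) != 0.
Proof.
move: t; apply: (tree_ind (t0 := t0)) => [|t k [skB detB]]; first by rewrite B0.
by rewrite Sigma_mut; split; [apply: mut_mx_skew skB | apply: mut_mx_det detB].
Qed.

(** Mutation of clusters involves no subtraction. *)
Lemma pattern_cluster t i : in_cone pattern_cone (cluster (Sigma t) i).
Proof.
move: t i; apply: (tree_ind (t0 := t0)) => [|t k xC] i.
  exact: laurent_cone_var.
rewrite Sigma_mut ffunE; case: ifP => // _.
apply: coneM; last exact: coneV.
by apply: coneD; (apply: coneM; first exact: laurent_cone_sf_inj);
  apply: cone_prod => j _; apply: coneXz.
Qed.

Lemma pattern_yhat_in t j : in_cone pattern_cone (yhat (Sigma t) j).
Proof.
apply: coneM; first exact: laurent_cone_sf_inj.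
by apply: cone_prod => i _; apply: coneXz; apply: pattern_cluster.
Qed.

Definition pattern_yhat t j : cone_sf pattern_cone :=
  to_cone (pattern_yhat_in t j).

Lemma pattern_yhat_mut t k j : pattern_yhat (nbr k t) j =
  y_mut k (exchange_mx (Sigma t)) (pattern_yhat t) j.
Proof.
apply: cone_sf_inj; rewrite [LHS]/= Sigma_mut yhat_mutation.
- by rewrite /y_mut; case: ifP => // _; case: ifP => _;
    rewrite !val_coneM !val_expsfz val_coneD.
- by apply: skew_diag; case: (pattern_mx t).
- by move=> i; apply: (cone_neq0 (pattern_cluster t i)).
- apply: (@cone_neq0 _ pattern_cone); apply: coneD; last exact: cone1.
  exact: pattern_yhat_in.
Qed.

Lemma pattern_coeffs_mut t k j : coeffs (Sigma (nbr k t)) j =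
  y_mut k (exchange_mx (Sigma t)) (coeffs (Sigma t)) j.
Proof. by rewrite Sigma_mut ffunE. Qed.

Lemma pattern_yhat_free : sf_free (pattern_yhat t0).
Proof.
apply: (laurent_sf_free (y := coeffs (Sigma t0)) B_nondeg) => j.
rewrite /= /yhat /laurent B0; congr (_ * _); apply: eq_bigr => i _.
by rewrite mxE.
Qed.

End Pattern.

Lemma pattern_mx_eq (P P' : semifieldType) n (B : 'M[int]_n) t0
    (Sigma : tree n -> seed P n) (Sigma' : tree n -> seed P' n) :
  seed_pattern B t0 Sigma -> seed_pattern B t0 Sigma' ->
  forall t, exchange_mx (Sigma t) = exchange_mx (Sigma' t).
Proof.
move=> [_ SB Smut] [_ SB' Smut']; apply: (tree_ind (t0 := t0)) => [|t k IH].
  by rewrite SB SB'.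
by rewrite Smut Smut' /= /mut_mx IH.
Qed.

(** Equivalence passes to the coefficients and the yhat of the other pattern by
    universality, and from the yhat back to the clusters by nondegeneracy. *)
Lemma seed_equiv_transfer (P P' : semifieldType) n (B : 'M[int]_n) t0
    (Sigma : tree n -> seed P n) (Sigma' : tree n -> seed P' n) t1 t2 :
  skew_symmetrizable B -> \det B != 0 ->
  seed_pattern B t0 Sigma -> seed_pattern B t0 Sigma' ->
  seed_equiv (Sigma t1) (Sigma t2) -> seed_equiv (Sigma' t1) (Sigma' t2).
Proof.
move=> skB detB SP SP' [s [sx sy sB]].
have mxE' := pattern_mx_eq SP SP'.
have sB' i j :
    exchange_mx (Sigma' t2) i j = exchange_mx (Sigma' t1) (s i) (s j).
  by rewrite -!mxE'.
have yhat_eq i : pattern_yhat SP t2 i = pattern_yhat SP t1 (s i).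
  apply: cone_sf_inj; rewrite /= /yhat sy.
  rewrite [in RHS](reindex_inj (@perm_inj _ s)) /=.
  by congr (_ * _); apply: eq_bigr => j _; rewrite sx sB.
have umut := pattern_yhat_mut skB detB SP.
have ufree := pattern_yhat_free (Sigma_pattern := SP) detB.
have sy' i : coeffs (Sigma' t2) i = coeffs (Sigma' t1) (s i).
  apply: (free_y_pattern_universal (y := fun t => coeffs (Sigma' t)) umut _
    ufree) (yhat_eq i) => t k j.
  by rewrite mxE'; apply: (pattern_coeffs_mut SP').
have yhat_eq' i : pattern_yhat SP' t2 i = pattern_yhat SP' t1 (s i).
  apply: (free_y_pattern_universal (y := pattern_yhat SP') umut _ ufree)
    (yhat_eq i) => t k j.
  by rewrite mxE'; apply: pattern_yhat_mut.
exists s; split=> // i.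
have xC t j := pattern_cluster SP' t j.
have x0 t j := cone_neq0 (xC t j).
have [_ detB2] := pattern_mx skB detB SP' t2.
apply: (mulIf (invr_neq0 (x0 t1 (s i)))); rewrite mulfV //; move: i.
apply: (monomial_map_injective (C := pattern_cone SP')
  (z := fun l => cluster (Sigma' t2) l / cluster (Sigma' t1) (s l)) detB2).
  by move=> l; apply: coneM => //; apply: coneV.
move=> j; have /(congr1 sval)/= := yhat_eq' j.
rewrite /yhat sy' => /(mulfI (sf_inj_neq0 _ _)) E.
under eq_bigr => l _ do rewrite expfzMl.
rewrite big_split /= E [X in X * _](reindex_inj (@perm_inj _ s)) /= -big_split.
rewrite big1 // => l _ /=; rewrite -sB' exprz_inv -expfzDr ?x0 // subrr.
exact: expr0z.
Qed.

Theorem theorem6 (n : nat) (B : 'M[int]_n)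
    (B_skew : skew_symmetrizable B) (B_nondeg : \det B != 0)
    (P P' : semifieldType) (t0 : tree n)
    (Sigma : tree n -> seed P n) (Sigma' : tree n -> seed P' n)
    (A_pattern : seed_pattern B t0 Sigma)
    (A'_pattern : seed_pattern B t0 Sigma')
    (t1 t2 : tree n) :
  seed_equiv (Sigma t1) (Sigma t2) <-> seed_equiv (Sigma' t1) (Sigma' t2).
Proof.
split; first exact: (seed_equiv_transfer B_skew B_nondeg A_pattern A'_pattern).
exact: (seed_equiv_transfer B_skew B_nondeg A'_pattern A_pattern).
Qed.
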